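(* Let $S:X\rightrightarrows Y$ be a set-valued mapping between reflexive Banach spaces, and let $\Omega\subset X$ be a closed and convex set. Let $(\bar x,\bar y)\in\operatorname{gph}S|_\Omega$ and assume that $\operatorname{gph}S|_\Omega$ is (locally) closed around $(\bar x,\bar y)$. Let $\varepsilon_0\in(0,1)$ and $\kappa_0\ge 0$ satisfy $\varepsilon_0=\frac{1}{\sqrt{\kappa_0^2+1}}$. Then the following statements are equivalent: (i) For any $\kappa>\kappa_0$, $S$ has the Lipschitz-like property relative to $\Omega$ around $(\bar x,\bar y)$ with constant $\kappa$. (ii) For any $\varepsilon\in(0,\varepsilon_0)$ there exists $\delta>0$ such that $$\widehat N^c_\varepsilon\big((x,y);\operatorname{gph}S|_\Omega\big)\cap\big[J(T(x;\Omega))\times\{0\}\big]=\{(0,0)\}$$ for all $(x,y)\in\operatorname{gph}S|_\Omega\cap[(\bar x+\delta B_X)\times(\bar y+\delta B_Y)]$. (iii) For any $\kappa>\kappa_0$ there exist $\gamma\in(0,\varepsilon_0)$ and $\delta>0$ such that $$\|x^*\|_{X^*}\le\kappa\|y^*\|_{Y^*}\quad\text{whenever}\quad (x^*,y^* )\in\widehat N^c_\gamma\big((x,y);\operatorname{gph}S|_\Omega\big)\cap\big[J(T(x;\Omega))\times Y^*\big]$$ for all $(x,y)\in\operatorname{gph}S|_\Omega\cap[(\bar x+\delta B_X)\times(\bar y+\delta B_Y)]$. Moreover, the exact Lipschitzian bound of $S$ relative to $\Omega$ at $(\bar x,\bar y)$ is given by $$\operatorname{lip}_\Omega S(\bar x,\bar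 y)=\lim_{\delta\downarrow0}\ \inf\Big\{\sqrt{\tfrac1{\varepsilon^2}-1}\ \Big|\ \varepsilon\in(0,1),\ \widehat N^c_\varepsilon\big((x,y);\operatorname{gph}S|_\Omega\big)\cap\big[J(T(x;\Omega))\times\{0\}\big]=\{(0,0)\}\ \text{for all }(x,y)\in\operatorname{gph}S|_\Omega\cap[(\bar x+\delta B_X)\times(\bar y+\delta B_Y)]\Big\}.$$
   Context: Conventions: every reflexive Banach space is equipped with an equivalent norm such that both the space and its dual are locally uniformly convex and the norm is Fréchet differentiable at each nonzero point. Products carry the norm $\|(x,y)\|_{X\times Y}=\sqrt{\|x\|_X^2+\|y\|_Y^2}$, and $\|(x^*,y^* )\|_{X^*\times Y^*}=\sqrt{\|x^*\|_{X^*}^2+\|y^*\|_{Y^*}^2}$. $B_X$, $B_Y$ are the closed unit balls. For $S:X\rightrightarrows Y$, $\operatorname{gph}S=\{(x,y)\mid y\in S(x)\}$, and $S|_\Omega$ is the restriction, so $\operatorname{gph}S|_\Omega=\{(x,y)\mid x\in\Omega,\ y\in S(x)\}$. The duality mapping is $J(x)=\{x^*\in X^*\mid\langle x^*,x\rangle=\|x\|_X^2,\ \|x^*\|_{X^*}=\|x\|_X\}$ (single-valued when $X$ carries an equivalent norm such that both $X$ and $X^*$ are locally uniformly convex and the norm is Fréchet differentiable at each nonzero point); $J(A)=\bigcup_{x\in A}J(x)$. The tangent (contingent) cone $T(\bar x;\Omega)$ to $\Omega$ at $\bar x\in\Omega$ is the set of $w\in X$ for which there are $t_k>0$, $t_k\to0$,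 and $w_k\to w$ with $\bar x+t_kw_k\in\Omega$ for all $k$. For $\varepsilon\ge0$, a Banach space $Z$, $\Lambda\subset Z$ and $\bar z\in\Lambda$, the $\varepsilon$-regular normal cone is $$\widehat N^c_\varepsilon(\bar z;\Lambda)=\Big\{z^*\in Z^*\ \Big|\ \limsup_{z\to\bar z,\ z\in\Lambda}\frac{\langle z^*,z-\bar z\rangle}{\|z-\bar z\|}\le\varepsilon\|z^*\|\Big\}$$ (the limsup is over $z\ne\bar z$; the condition is vacuous if $\bar z$ is isolated in $\Lambda$). $S$ has the Lipschitz-like property relative to $\Omega$ around $(\bar x,\bar y)\in\operatorname{gph}S|_\Omega$ with constant $\kappa\ge0$ if there are neighborhoods $V$ of $\bar x$ and $W$ of $\bar y$ such that $S(x')\cap W\subset S(x)+\kappa\|x'-x\|_XB_Y$ for all $x,x'\in\Omega\cap V$. The exact Lipschitzian bound $\operatorname{lip}_\Omega S(\bar x,\bar y)$ is the infimum of all $\kappa\ge0$ for which such neighborhoods exist (with $\inf\emptyset=\infty$). *)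

(* Defs.v *)
From HB Require Import structures.
From mathcomp Require Import all_boot all_order all_algebra.
From mathcomp Require Import all_classical all_reals all_analysis.

Set Implicit Arguments.
Unset Strict Implicit.
Unset Printing Implicit Defensive.

Import Order.TTheory GRing.Theory Num.Theory.
Import numFieldNormedType.Exports.

Local Open Scope classical_set_scope.
Local Open Scope ring_scope.

(* The library has no topological dual of a normed space: [dual X] is the
   space of continuous linear functionals on [X] with the operator norm. *)

Section dual.
Context {R : realType} (X : normedModType R).

Definition continuous_linear : {pred X -> R^o} :=
  fun f => `[< linear f /\ continuous f >].

Lemma continuous_linear_submod_closed : submod_closed continuous_linear.
Proof.
split=> [|a f g].
  apply/asboolP; split=> [a x y|]; last exact: cst_continuous.
  by change (0 = a *: 0 + 0 :> R^o); rewrite scaler0 addr0.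
move=> /asboolP[lf cf] /asboolP[lg cg]; apply/asboolP; split=> [b x y|x].
  change (a *: f (b *: x + y) + g (b *: x + y) =
          b *: (a *: f x + g x) + (a *: f y + g y)).
  by rewrite lf lg !scalerDr !scalerA [a * b]mulrC addrACA.
by apply: continuousD; [apply: continuousZl_tmp; exact: cf|exact: cg].
Qed.

HB.instance Definition _ := GRing.isSubmodClosed.Build R (X -> R^o)
  continuous_linear continuous_linear_submod_closed.

Record dual := Dual {
  dual_fun :> X -> R^o ;
  dual_fun_subproof : dual_fun \in continuous_linear }.

HB.instance Definition _ := [isSub for dual_fun].
HB.instance Definition _ := [Choice of dual by <:].
HB.instance Definition _ := [SubChoice_isSubLmodule of dual by <:].

Lemma dual_linear (f : dual) : linear f.
Proof. by have /asboolP[] := dual_fun_subproof f. Qed.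

HB.instance Definition _ (f : dual) :=
  GRing.isLinear.Build R X R^o *:%R f (dual_linear f).

Lemma dual_continuous (f : dual) : continuous f.
Proof. by have /asboolP[] := dual_fun_subproof f. Qed.

Lemma dualP (f g : dual) : f =1 g -> f = g.
Proof. by move=> fg; apply/val_inj/funext. Qed.

Definition dual_norm (f : dual) : R :=
  sup [set `|f x| | x in closed_ball (0 : X) 1].

Lemma closed_ball01 (x : X) : closed_ball (0 : X) 1 x <-> `|x| <= 1.
Proof. by rewrite closed_ballE// /closed_ball_ /= sub0r normrN. Qed.

Lemma dual_has_sup (f : dual) :
  has_sup [set `|f x| | x in closed_ball (0 : X) 1].
Proof.
split; first by exists `|f 0|, 0 => //; apply/closed_ball01; rewrite normr0.
have /continuous_linear_bounded/bounded_funP/(_ 1)[M fM] :=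
  @dual_continuous f 0.
by exists M => _ [x /closed_ball01 x1 <-]; exact: fM.
Qed.

Lemma dual_norm_ge0 (f : dual) : 0 <= dual_norm f.
Proof.
apply: le_trans (normr_ge0 (f 0)) _; apply: (ub_le_sup (dual_has_sup f).2).
by exists 0 => //; apply/closed_ball01; rewrite normr0.
Qed.

Lemma dual_norm_le (f : dual) (x : X) : `|f x| <= dual_norm f * `|x|.
Proof.
have [->|x0] := eqVneq x 0; first by rewrite linear0 !normr0 mulr0.
have nx0 : 0 < `|x| by rewrite normr_gt0.
rewrite -ler_pdivrMr//; apply: (ub_le_sup (dual_has_sup f).2).
exists (`|x|^-1 *: x).
  by apply/closed_ball01; rewrite normrZ normfV normr_id mulVf// gt_eqF.
by rewrite linearZ /= normrZ normfV normr_id mulrC.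
Qed.

Lemma dual_norm_lub (f : dual) (M : R) : 0 <= M ->
  (forall x, `|f x| <= M * `|x|) -> dual_norm f <= M.
Proof.
move=> M0 fM; apply: sup_le_ub; first exact: (dual_has_sup f).1.
move=> _ [x /closed_ball01 x1 <-]; apply: le_trans (fM x) _.
by rewrite -[leRHS]mulr1 ler_wpM2l.
Qed.

Lemma dual_normD (f g : dual) :
  dual_norm (f + g) <= dual_norm f + dual_norm g.
Proof.
apply: dual_norm_lub => [|x]; first by rewrite addr_ge0 ?dual_norm_ge0.
rewrite mulrDl; apply: le_trans (ler_normD (f x) (g x)) _.
by rewrite lerD ?dual_norm_le.
Qed.

Lemma dual_normZ (a : R) (f : dual) : dual_norm (a *: f) = `|a| * dual_norm f.
Proof.
have le_normZ b h : dual_norm (b *: h) <= `|b| * dual_norm h.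
  apply: dual_norm_lub => [|x]; first by rewrite mulr_ge0 ?dual_norm_ge0.
  rewrite -mulrA (_ : (b *: h) x = b *: h x)// normrZ.
  by rewrite ler_wpM2l ?dual_norm_le.
apply/eqP; rewrite eq_le le_normZ/=.
have [->|a0] := eqVneq a 0; first by rewrite normr0 mul0r dual_norm_ge0.
rewrite -ler_pdivlMl ?normr_gt0// -normfV.
by rewrite -{1}[f](scalerK a0) le_normZ.
Qed.

Lemma dual_norm0_eq0 (f : dual) : dual_norm f = 0 -> f = 0.
Proof.
move=> f0; apply: dualP => x; apply/eqP; rewrite -normr_le0.
by rewrite (le_trans (dual_norm_le f x))// f0 mul0r.
Qed.

HB.instance Definition _ := Lmodule_isNormed.Build R dual
  dual_normD dual_normZ dual_norm0_eq0.

End dual.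

Section geometry_of_norms.
Context {R : realType}.

(* the canonical embedding of X into its bidual is onto *)
Definition reflexive_space (X : normedModType R) : Prop :=
  forall phi : dual (dual X), exists x : X, forall f : dual X, phi f = f x.

Definition locally_uniformly_convex (X : normedModType R) : Prop :=
  forall x : X, `|x| = 1 -> forall e : R, 0 < e ->
  exists2 d : R, 0 < d & forall y : X, `|y| = 1 -> e <= `|x - y| ->
    `|2^-1 *: (x + y)| <= 1 - d.

Definition frechet_smooth_norm (X : normedModType R) : Prop :=
  forall x : X, x != 0 -> differentiable (fun u : X => `|u| : R^o) x.

Definition standing_renorming (X : normedModType R) : Prop :=
  [/\ locally_uniformly_convex X, locally_uniformly_convex (dual X)
    & frechet_smooth_norm X].

(* The library's norm on a product is the maximum of the two norms, with the
   same topology; [l2norm] serves both X * Y and dual X * dual Y. *)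
Definition l2norm (U V : normedModType R) (p : U * V) : R :=
  Num.sqrt (`|p.1| ^+ 2 + `|p.2| ^+ 2).

Definition duality_map (X : normedModType R) (x : X) : set (dual X) :=
  [set f : dual X | f x = `|x| ^+ 2 /\ `|f| = `|x|].

Definition duality_image (X : normedModType R) (A : set X) : set (dual X) :=
  \bigcup_(x in A) duality_map x.

Definition tangent_cone (X : normedModType R) (xbar : X) (Omega : set X) :
    set X :=
  [set w | exists t : nat -> R, exists w_ : nat -> X,
    [/\ forall k, 0 < t k, t @ \oo --> (0 : R), w_ @ \oo --> w
      & forall k, Omega (xbar + t k *: w_ k)]].

End geometry_of_norms.

Section set_valued_mappings.
Context {R : realType} {X Y : normedModType R}.

Definition gph (S : X -> set Y) : set (X * Y) := [set p | S p.1 p.2].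

Definition restriction (S : X -> set Y) (Omega : set X) : X -> set Y :=
  fun x => [set y | Omega x /\ S x y].

Definition locally_closed_around (A : set (X * Y)) (p : X * Y) : Prop :=
  exists U : set (X * Y), [/\ nbhs p U, closed U & closed (A `&` U)].

(* The space is Z = X * Y with the norm [l2norm], and its dual is represented
   by dual X * dual Y, a pair acting by the sum of its components.  At an
   isolated point of Lambda the upper limit is -oo. *)
Definition eps_normal_cone (eps : R) (z : X * Y) (Lambda : set (X * Y)) :
    set (dual X * dual Y) :=
  [set zs : dual X * dual Y | (limf_esup
      (fun w : X * Y =>
        ((zs.1 (w.1 - z.1) + zs.2 (w.2 - z.2)) / l2norm (w - z))%:E)
      (within Lambda z^') <= (eps * l2norm zs)%:E)%E].

Definition lipschitz_like (S : X -> set Y) (Omega : set X)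
    (xbar : X) (ybar : Y) (kappa : R) : Prop :=
  exists V W, [/\ nbhs xbar V, nbhs ybar W &
    forall x x', (Omega `&` V) x -> (Omega `&` V) x' ->
      S x' `&` W `<=` [set u + (kappa * `|x' - x|) *: b |
                        u in S x & b in closed_ball (0 : Y) 1]].

Definition lip (S : X -> set Y) (Omega : set X) (xbar : X) (ybar : Y) :
    \bar R :=
  ereal_inf [set kappa%:E | kappa in
    [set kappa | 0 <= kappa /\ lipschitz_like S Omega xbar ybar kappa]].

Definition trivial_normals (S : X -> set Y) (Omega : set X)
    (xbar : X) (ybar : Y) (eps delta : R) : Prop :=
  forall x y,
    (gph (restriction S Omega) `&`
       (closed_ball xbar delta `*` closed_ball ybar delta)) (x, y) ->
    eps_normal_cone eps (x, y) (gph (restriction S Omega)) `&`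
      (duality_image (tangent_cone x Omega) `*` [set 0]) = [set (0, 0)].

End set_valued_mappings.

(* Main.v *)
Require Import Defs.
From HB Require Import structures.
From mathcomp Require Import all_boot all_order all_algebra.
From mathcomp Require Import all_classical all_reals all_analysis.
From mathcomp Require Import ring lra.
Import Order.TTheory GRing.Theory Num.Theory.
Import numFieldNormedType.Exports.
Local Open Scope classical_set_scope.
Local Open Scope ring_scope.

(* The sufficiency of the normal cone conditions needs no calculus of normal
   cones.  Let (x', y') be in the graph G of S restricted to Omega, let x be in
   Omega, and let r = ||x' - x||.  Apply Ekeland's principle on G, for the
   Euclidean product norm and with a constant lambda, to
     f(u, v) = ||u - x|| + mu (sqrt(||v - y'||^2 + s^2) - s)
   started at (x', y').  If the resulting point has the form (x, v), then
   f(x, v) + lambda ||(x, v) - (x', y')|| <= r bounds ||v - y'|| by kappa r.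
   Otherwise f is Frechet smooth at the resulting point (u, v), its negative
   gradient gives an element (xi, eta) of the lambda-normal cone with
   ||eta|| <= mu ||xi||, and xi is a positive multiple of J(x - u), where x - u
   is tangent to Omega at u by convexity.  The choice mu = 0 and
   lambda = (kappa^2 + 1)^(-1/2) yields (ii) => (i), and mu = 1/kappa with
   lambda = gamma yields (iii) => (i).  The necessity follows by
   testing a normal along the graph points that the Lipschitz-like property
   provides over a tangent sequence. *)

(** The two sides differ by (b - a)^2 / (2a). This tangent bound for the concave square root turns
    increments of squared norms into increments of norms. *)
Lemma lerB_sqr_div (R : realType) (a b : R) : 0 < a ->
  b - a <= (b ^+ 2 - a ^+ 2) / (2 * a).
Proof.
move=> a0; rewrite ler_pdivlMr ?mulr_gt0// -subr_ge0.
by apply: le_trans (sqr_ge0 (b - a)) _; lra.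
Qed.

Lemma continuous_sqr_norm (R : realType) (V : normedModType R) :
  continuous (fun v : V => `|v| ^+ 2).
Proof. by move=> v; apply: cvgM; exact: norm_continuous. Qed.

(** * The Euclidean norm on a product *)

Section l2norm.
Context {R : realType} {U V : normedModType R}.
Implicit Types p q : U * V.

Lemma l2norm_ge0 p : 0 <= l2norm p.
Proof. exact: sqrtr_ge0. Qed.

Lemma l2normE2 p : l2norm p ^+ 2 = `|p.1| ^+ 2 + `|p.2| ^+ 2.
Proof. by rewrite sqr_sqrtr// addr_ge0// sqr_ge0. Qed.

Lemma ler_l2norm1 p : `|p.1| <= l2norm p.
Proof. by rewrite -ler_sqr ?nnegrE ?l2norm_ge0// l2normE2 lerDl sqr_ge0. Qed.

Lemma ler_l2norm2 p : `|p.2| <= l2norm p.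
Proof. by rewrite -ler_sqr ?nnegrE ?l2norm_ge0// l2normE2 lerDr sqr_ge0. Qed.

Lemma l2norm_le_sum p : l2norm p <= `|p.1| + `|p.2|.
Proof.
rewrite -ler_sqr ?nnegrE ?l2norm_ge0 ?addr_ge0// l2normE2.
by rewrite sqrrD addrAC lerDl mulrn_wge0// mulr_ge0.
Qed.

Lemma l2norm0 : l2norm (0 : U * V) = 0.
Proof. by rewrite /l2norm/= !normr0 expr0n/= addr0 sqrtr0. Qed.

Lemma l2normD p q : l2norm (p + q) <= l2norm p + l2norm q.
Proof.
have Np := l2norm_ge0 p; have Nq := l2norm_ge0 q.
have Hp := l2normE2 p; have Hq := l2normE2 q.
rewrite -ler_sqr ?nnegrE ?l2norm_ge0 ?addr_ge0// l2normE2.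
set a := l2norm p in Np Hp *; set b := l2norm q in Nq Hq *.
apply: (@le_trans _ _ ((`|p.1| + `|q.1|) ^+ 2 + (`|p.2| + `|q.2|) ^+ 2)).
  by rewrite lerD// ler_sqr ?nnegrE ?addr_ge0// ler_normD.
(* What remains is Cauchy-Schwarz in the plane, whose defect is the square of a determinant. *)
suff : `|p.1| * `|q.1| + `|p.2| * `|q.2| <= a * b by nra.
rewrite -ler_sqr ?nnegrE ?addr_ge0 ?mulr_ge0// exprMn Hp Hq.
rewrite -subr_ge0.
apply: le_trans (sqr_ge0 (`|p.1| * `|q.2| - `|p.2| * `|q.1|)) _.
by rewrite le_eqVlt; apply/orP; left; apply/eqP; ring.
Qed.

Lemma l2norm_gt0 p : p != 0 -> 0 < l2norm p.
Proof.
move=> p0; rewrite lt_def l2norm_ge0 andbT; apply: contra p0 => /eqP N0.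
have := ler_l2norm1 p; have := ler_l2norm2 p; rewrite N0 !normr_le0.
by case: p {N0} => p1 p2 /= /eqP -> /eqP ->.
Qed.

Lemma continuous_l2norm : continuous (@l2norm R U V).
Proof.
move=> p; apply: (@continuous_comp _ _ _
  (fun p : U * V => `|p.1| ^+ 2 + `|p.2| ^+ 2)); last exact: sqrt_continuous.
have c1 : continuous (fun q : U * V => `|q.1| ^+ 2).
  move=> q; apply: (@continuous_comp _ _ _ fst (fun u : U => `|u| ^+ 2)).
    exact: cvg_fst.
  exact: continuous_sqr_norm.
have c2 : continuous (fun q : U * V => `|q.2| ^+ 2).
  move=> q; apply: (@continuous_comp _ _ _ snd (fun u : V => `|u| ^+ 2)).
    exact: cvg_snd.
  exact: continuous_sqr_norm.
exact: (cvgD (c1 p) (c2 p)).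
Qed.

End l2norm.

(** * Ekeland's variational principle *)

Section ekeland.
Context {R : realType} {X Y : completeNormedModType R}.

(** [D z] collects the points of [A] that lower [f] from [z] at rate at least [lambda]. Nearly
    minimizing [f] over such closed sets in turn makes their radii tend to zero, and the limit point
    lies in all of them. *)
Lemma ekeland (A : set (X * Y)) (f : X * Y -> R) (lambda : R) (p : X * Y) :
  closed A -> continuous f -> (forall q, 0 <= f q) -> 0 < lambda -> A p ->
  exists z, [/\ A z, f z + lambda * l2norm (z - p) <= f p &
    forall q, A q -> f z <= f q + lambda * l2norm (q - z)].
Proof.
move=> clA ctf f0 l0 Ap.
pose D z := [set w | A w /\ f w + lambda * l2norm (w - z) <= f z].
have Dz z : A z -> D z z.
  by move=> Az; split; rewrite // subrr l2norm0 mulr0 addr0.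
have Dtr z w : D z w -> D w `<=` D z.
  move=> [Aw wz] q [Aq qw]; split=> //.
  have := l2normD (q - w) (w - z); rewrite addrA subrK => tri.
  by have := ler_wpM2l (ltW l0) tri; lra.
have clD z : closed (D z).
  apply: closedI => //.
  pose g q : R := f q + lambda * l2norm (q - z).
  have ctg : continuous g.
    move=> q; apply: cvgD; first exact: ctf.
    apply: cvgM; first exact: cvg_cst.
    apply: (@continuous_comp _ _ _ (fun q : X * Y => q - z) (@l2norm R X Y));
      last exact: continuous_l2norm.
    by apply: (@continuousB R _ _ id (cst z)); [exact: cvg_id|exact: cvg_cst].
  exact: (closed_comp (fun q _ => ctg q) (@closed_le R (f z))).
pose e n : R := n.+1%:R^-1.
have e0 n : 0 < e n by rewrite invr_gt0.
(* The premise [A z] stands under the existential so that the choice [nxt] is total. *)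
have step (n : nat) z :
    exists w, A z -> D z w /\ forall q, D z q -> f w <= f q + e n.
  have [Az|nA] := pselect (A z); last by exists z.
  have hi : has_inf (f @` D z).
    split; first by exists (f z), z => //; exact: Dz.
    by exists 0 => _ [q _ <-].
  have [_ [w Dw <-] wlt] := inf_adherent (e0 n) hi.
  exists w => _; split=> // q Dq; apply: (le_trans (ltW wlt)).
  by rewrite lerD2r; apply: ge_inf; [exact: hi.2|exists q].
pose nxt n z := projT1 (cid (step n z)).
have nxtP n z :
    A z -> D z (nxt n z) /\ forall q, D z q -> f (nxt n z) <= f q + e n.
  exact: projT2 (cid (step n z)).
pose z_ := fix z_ n := if n is m.+1 then nxt m (z_ m) else p.
have Az n : A (z_ n).
  by elim: n => //= n ih; have [[]] := nxtP n _ ih.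
have Dmn n m : (n <= m)%N -> D (z_ n) (z_ m).
  move=> /subnK <-; elim: (m - n)%N => [|k ih]; first exact: Dz.
  apply: (Dtr _ _ ih); have [] := nxtP (k + n)%N _ (Az (k + n)%N);
    by rewrite addSn.
(* [D (z_ n.+1)] lies in [D (z_ n)], so on it [f] drops at most [e n] below its value at [z_ n.+1];
   this bounds the radius. *)
have small n q : D (z_ n.+1) q -> lambda * l2norm (q - z_ n.+1) <= e n.
  move=> Dq; have [_ qz] := Dq.
  have [D1 /(_ q)] := nxtP n _ (Az n); rewrite -[nxt _ _]/(z_ n.+1) => h.
  by have := h (Dtr _ _ D1 _ Dq); lra.
have e_lt (d : R) : 0 < d -> exists n, e n < lambda * d.
  move=> d0; have := near_infty_natSinv_lt (PosNum (mulr_gt0 l0 d0)).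
  by move=> [n _ /(_ n (leqnn _))]; exists n.
have cvgz : exists z : X * Y, z_ n @[n --> \oo] --> z.
  have near_z d : 0 < d ->
      exists n, forall m, (n <= m)%N -> l2norm (z_ m - z_ n) < d.
    move=> d0; have [n en] := e_lt _ d0; exists n.+1 => m nm.
    by rewrite -(ltr_pM2l l0); apply: le_lt_trans en; apply/small/Dmn.
  have c1 : cvg ((z_ n).1 @[n --> \oo]).
    apply/cauchy_cvgP/cauchy_exP => d d0; have [n zn] := near_z _ d0.
    exists (z_ n).1; exists n => // m /= nm; rewrite -ball_normE /ball_/=.
    rewrite distrC; apply: le_lt_trans (zn _ nm);
      exact: (ler_l2norm1 (z_ m - z_ n)).
  have c2 : cvg ((z_ n).2 @[n --> \oo]).
    apply/cauchy_cvgP/cauchy_exP => d d0; have [n zn] := near_z _ d0.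
    exists (z_ n).2; exists n => // m /= nm; rewrite -ball_normE /ball_/=.
    rewrite distrC; apply: le_lt_trans (zn _ nm);
      exact: (ler_l2norm2 (z_ m - z_ n)).
  exists (lim ((z_ n).1 @[n --> \oo]), lim ((z_ n).2 @[n --> \oo])).
  rewrite (_ : z_ = fun n => ((z_ n).1, (z_ n).2)); last first.
    by apply/funext => n; case: (z_ n).
  exact: (cvg_pair c1 c2).
have [z zlim] := cvgz.
have Dnz n : D (z_ n) z.
  apply: (closed_cvg (D (z_ n)) (clD _) _ _ zlim) => //.
  by exists n => // m /= nm; exact: Dmn.
exists z; have [Az' zp] := Dnz 0%N; split=> // q Aq.
rewrite leNgt; apply/negP => qlt.
have Dzq : D z q by split=> //; exact: ltW.
have zq : z != q.
  by apply/eqP => zq; move: qlt; rewrite zq subrr l2norm0 mulr0 addr0 ltxx.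
have N0 : 0 < l2norm (q - z) by apply: l2norm_gt0; rewrite subr_eq0 eq_sym.
have qfz : lambda * l2norm (q - z) < f z - f q by lra.
(* Such a [q] lies in every [D (z_ n)], so [f z - f q] is at most each [e n], yet it exceeds a fixed
   positive number. *)
have [n en] : exists n, e n < lambda * l2norm (q - z) by exact: e_lt.
have [D1 /(_ q)] := nxtP n _ (Az n); rewrite -[nxt _ _]/(z_ n.+1) => h.
have := h (Dtr _ _ (Dnz n) _ Dzq).
have [_] := Dnz n.+1; have := mulr_ge0 (ltW l0) (l2norm_ge0 (z - z_ n.+1)); lra.
Qed.

End ekeland.

(** A slack [e] replaces the upper limit. Multiplying by the distance makes the inequality trivial
    at [w = z], so the punctured neighbourhood becomes a ball of the maximum norm. *)
Lemma eps_normal_coneP (R : realType) (X Y : normedModType R) (eps : R)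
    (z : X * Y) (L : set (X * Y)) (zs : dual X * dual Y) :
  eps_normal_cone eps z L zs <->
  forall e, 0 < e -> exists2 d, 0 < d & forall w, L w -> `|w - z| < d ->
    zs.1 (w.1 - z.1) + zs.2 (w.2 - z.2) <=
      (eps * l2norm zs + e) * l2norm (w - z).
Proof.
split=> [lim e e0|H].
  have : (limf_esup (fun w : X * Y =>
        ((zs.1 (w.1 - z.1) + zs.2 (w.2 - z.2)) / l2norm (w - z))%:E)
      (within L z^') < (eps * l2norm zs + e)%:E)%E.
    by apply: le_lt_trans lim _; rewrite lte_fin ltrDl.
  move=> /ereal_inf_lt[_ [V LV <-] supV].
  have /nbhs_ballP[d /= d0 dV] : nbhs z [set w | w != z -> L w -> V w] by
    exact: LV.
  exists d => // w Lw wd.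
  have [->|wz] := eqVneq w z;
    first by rewrite !subrr !linear0 l2norm0 mulr0 addr0.
  rewrite -ler_pdivrMr ?l2norm_gt0 ?subr_eq0// -lee_fin.
  apply: le_trans (ltW supV); apply: ereal_sup_ubound; exists w => //.
  by apply: dV => //; rewrite -ball_normE /ball_ /= distrC.
apply/lee_addgt0Pr => e e0; have [d d0 dL] := H e e0.
pose V := [set w | [/\ L w, w != z & `|w - z| < d]].
apply: (@le_trans _ _ (ereal_sup [set
    ((zs.1 (w.1 - z.1) + zs.2 (w.2 - z.2)) / l2norm (w - z))%:E | w in V])).
  apply: ereal_inf_lbound; exists V => //.
  apply/nbhs_ballP; exists d => //= w;
    rewrite -ball_normE /ball_ /= distrC => wd wz Lw.
  by split.
apply: ub_ereal_sup => _ [w [Lw wz wd] <-]; rewrite -EFinD lee_fin.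
by rewrite ler_pdivrMr ?l2norm_gt0 ?subr_eq0//; exact: dL.
Qed.

(** * Derivatives of the norm and of its square *)

Section smooth.
Context {R : realType} {X : normedModType R}.

(** Along the ray through [v] the norm is linear, which determines [D v]; the norm is 1-Lipschitz,
    which bounds [D]. *)
Lemma norm_derivative (smoothX : frechet_smooth_norm X) (v : X) : v != 0 ->
  exists2 D : dual X, [/\ `|D| <= 1 & D v = `|v|] &
    forall e, 0 < e -> exists2 d, 0 < d &
      forall h, `|h| < d -> `| `|v + h| - `|v| - D h | <= e * `|h|.
Proof.
move=> v0; pose N := fun u : X => `|u| : R^o.
have /diff_locallyP[ctD /eqaddoP diffN] := smoothX v v0.
have Dcl : ('d N v : X -> R^o) \in @continuous_linear R X.
  by apply/asboolP; split=> //; exact: linearP.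
pose D := Dual Dcl.
have DE e : 0 < e -> exists2 d, 0 < d &
    forall h, `|h| < d -> `| `|v + h| - `|v| - D h | <= e * `|h|.
  move=> e0.
  have /nbhs_ballP[d /= d0 dE] := diffN e e0; exists d => // h hd.
  have := dE h; rewrite -ball_normE /ball_ /= sub0r normrN => /(_ hd).
  rewrite (_ : (_ - _) h = `|h + v| - (`|v| + D h))//.
  by rewrite opprD addrA [h + v]addrC.
have Dv : D v = `|v|.
  apply/eqP; rewrite eq_sym -subr_eq0 -normr_le0.
  apply/ler_addgt0Pr => e e0; rewrite add0r.
  have nv : 0 < `|v| by rewrite normr_gt0.
  (* The increment has norm d / 2; dividing by its scalar factor turns the tolerance e / |v| into
     [e]. *)
  have [d d0 /(_ ((d / (2 * `|v|)) *: v))] := DE (e / `|v|) (divr_gt0 e0 nv).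
  have t0 : 0 < d / (2 * `|v|) by rewrite divr_gt0 ?mulr_gt0.
  rewrite normrZ gtr0_norm// => /(_ _)/wrap[].
    by rewrite invfM mulrA mulfVK ?gt_eqF//; lra.
  rewrite -{1}[v]scale1r -scalerDl normrZ gtr0_norm ?addr_gt0//.
  rewrite linearZ /= -[_ *: D v]/(_ * D v).
  set t := d / _ in t0 *.
  rewrite (_ : _ - _ - _ = t * (`|v| - D v)); last by ring.
  rewrite normrM gtr0_norm// (_ : _ * (t * _) = t * e).
    by rewrite ler_pM2l.
  by field; rewrite gt_eqF.
exists D => //; split; last exact: Dv.
apply: dual_norm_lub => // h; rewrite mul1r.
apply/ler_addgt0Pr => e e0.
have [->|h0] := eqVneq h 0; first by rewrite linear0 !normr0 add0r ltW.
have nh : 0 < `|h| by rewrite normr_gt0.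
have [d d0 /(_ ((d / (2 * `|h|)) *: h))] := DE (e / `|h|) (divr_gt0 e0 nh).
have t0 : 0 < d / (2 * `|h|) by rewrite divr_gt0 ?mulr_gt0.
rewrite normrZ gtr0_norm// => /(_ _)/wrap[].
  by rewrite invfM mulrA mulfVK ?gt_eqF//; lra.
rewrite linearZ /= -[_ *: D h]/(_ * D h).
set t := d / _ in t0 * => le_e.
have le_th : `| `|v + t *: h| - `|v| | <= t * `|h|.
  apply: le_trans (ler_dist_dist _ _) _.
  by rewrite addrC addKr normrZ gtr0_norm.
rewrite -(ler_pM2l t0) -{1}(gtr0_norm t0) -normrM.
have -> : t * (`|h| + e) = t * `|h| + e / `|h| * (t * `|h|).
  by field; rewrite gt_eqF.
apply: le_trans (lerD le_th le_e).
rewrite [X in `|X| <= _](_ :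
    _ = (`|v + t *: h| - `|v|) - (`|v + t *: h| - `|v| - t * D h)).
  exact: ler_normB.
by ring.
Qed.

(* The square also covers v = 0, where the norm is not differentiable. *)
Lemma sqr_norm_subgradient (smoothX : frechet_smooth_norm X) (v : X) :
  exists2 f : dual X, duality_map v f &
    forall e, 0 < e -> exists2 d, 0 < d &
      forall h, `|h| < d -> `|v + h| ^+ 2 - `|v| ^+ 2 <= 2 * f h + e * `|h|.
Proof.
have [->|v0] := eqVneq v 0.
  exists 0; first by split; rewrite ?linear0 !normr0 ?expr0n.
  move=> e e0; exists e => // h he; rewrite add0r normr0 expr0n/= subr0.
  rewrite [X in 2 * X](_ : _ = 0)//.
  by rewrite mulr0 add0r expr2 ler_wpM2r// ltW.
have [D [D1 Dv] DE] := norm_derivative smoothX _ v0.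
have nv : 0 < `|v| by rewrite normr_gt0.
have nD : `|D| = 1.
  apply/eqP; rewrite eq_le D1/=.
  have := dual_norm_le D v; rewrite Dv normr_id -{1}[`|v|]mul1r ler_pM2r//.
exists (`|v| *: D).
  by split; [rewrite -[LHS]/(`|v| * D v) Dv expr2|rewrite normrZ normr_id nD
    mulr1].
(* With a = |v + h|, the increment is 2|v|(a - |v|) + (a - |v|)^2: the first term costs e/2 times
   |h|, and |h| < e/2 bounds the second likewise. *)
move=> e e0; have e1 : 0 < e / (4 * `|v|) by rewrite divr_gt0 ?mulr_gt0.
have [d d0 dE] := DE _ e1.
exists (Order.min d (e / 2)); first by rewrite lt_min d0 divr_gt0.
move=> h; rewrite lt_min => /andP[/dE hd he].
rewrite -[(_ *: D) h]/(`|v| * D h).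
have le_h : `| `|v + h| - `|v| | <= `|h|.
  by apply: le_trans (ler_dist_dist _ _) _; rewrite addrC addKr.
set a := `|v + h| in hd le_h *.
have : (a - `|v|) ^+ 2 <= e / 2 * `|h|.
  rewrite -real_normK ?num_real// expr2.
  apply: (@le_trans _ _ (`|h| * `|h|)); first by rewrite ler_pM.
  by rewrite ler_wpM2r// ltW.
have : `|v| * (a - `|v| - D h) <= e / 4 * `|h|.
  have -> : e / 4 * `|h| = `|v| * (e / (4 * `|v|) * `|h|) by field;
    rewrite gt_eqF.
  by rewrite ler_pM2l//; apply: le_trans hd; exact: ler_norm.
by nra.
Qed.

End smooth.

(** The segment from [u] to [x] stays in [Omega], so a constant direction with steps 1/(k+1), never
    above 1, is admissible. *)
Lemma convex_tangent_cone (R : realType) (X : normedModType R) (Omega : set X)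
    (u x : X) :
  convex_set Omega -> Omega u -> Omega x -> tangent_cone u Omega (x - u).
Proof.
move=> cO Ou Ox; exists (fun k => k.+1%:R^-1), (fun=> x - u); split.
- by move=> k; rewrite invr_gt0.
- exact: cvg_harmonic.
- exact: cvg_cst.
move=> k; have t0 : 0 <= k.+1%:R^-1 :> R by rewrite invr_ge0.
have t1 : k.+1%:R^-1 <= 1 :> R by rewrite invf_le1// ler1n.
have := cO x u (Itv01 t0 t1); rewrite !inE => /(_ Ox Ou).
move=> Oc; rewrite [X in Omega X](_ :
  _ = k.+1%:R^-1 *: x + (1 - k.+1%:R^-1) *: u)//.
by rewrite scalerBr scalerBl scale1r addrCA addrC -!addrA addrCA.
Qed.

(** * Normals from Ekeland's principle *)

Section variational.
Context {R : realType} {X Y : completeNormedModType R}.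

(** As [G] is closed only locally, Ekeland's principle is applied on [G] intersected with [U]. The
    point found stays within r / lambda of the start, hence interior to [U], so its normals can be
    tested on [G] itself. The parameter [s] smooths the norm at v = y'. *)
Lemma ekeland_normal (smoothX : frechet_smooth_norm X)
    (smoothY : frechet_smooth_norm Y)
    (G U : set (X * Y)) (Omega : set X) (x x' : X) (y' : Y)
    (mu lambda s : R) :
  convex_set Omega -> (forall q, G q -> Omega q.1) -> closed (G `&` U) ->
  0 <= mu -> 0 < lambda -> 0 < s -> Omega x -> G (x', y') ->
  (forall q, `|q - (x', y')| <= `|x' - x| / lambda -> nbhs q U) ->
  (exists2 v, G (x, v) & mu * (Num.sqrt (`|v - y'| ^+ 2 + s ^+ 2) - s) +
    lambda * l2norm ((x, v) - (x', y')) <= `|x' - x|) \/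
  exists u v xs ys, [/\ G (u, v) /\ `|(u, v) - (x', y')| <= `|x' - x| / lambda,
    eps_normal_cone lambda (u, v) G (xs, ys),
    duality_image (tangent_cone u Omega) xs, xs != 0 & `|ys| <= mu * `|xs|].
Proof.
move=> cO GO clG mu0 l0 s0 Ox Gp Unbhs.
set p := (x', y') in Gp Unbhs *; set r := `|x' - x| in Unbhs *.
pose psi (v : Y) : R := Num.sqrt (`|v - y'| ^+ 2 + s ^+ 2).
have psiE v : psi v ^+ 2 = `|v - y'| ^+ 2 + s ^+ 2.
  by rewrite sqr_sqrtr// addr_ge0// sqr_ge0.
have psi_s v : s <= psi v.
  by rewrite -ler_sqr ?nnegrE ?(ltW s0) ?sqrtr_ge0// psiE lerDr sqr_ge0.
have psi_v v : `|v - y'| <= psi v.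
  by rewrite -ler_sqr ?nnegrE ?sqrtr_ge0// psiE lerDl sqr_ge0.
(* Subtracting [s] makes the starting value exactly [r]. *)
pose f (q : X * Y) : R := `|q.1 - x| + mu * (psi q.2 - s).
have fp : f p = r.
  by rewrite /f /psi /p /= subrr normr0 expr0n/= add0r sqrtr_sqr gtr0_norm//
    subrr mulr0 addr0.
have f0 q : 0 <= f q by rewrite addr_ge0// mulr_ge0// subr_ge0.
have ctf : continuous f.
  have c1 : continuous (fun q : X * Y => `|q.1 - x|).
    move=> q; apply: (@continuous_comp _ _ _ (fun q : X * Y => q.1 - x)
      (fun h : X => `|h|)); last exact: norm_continuous.
    by apply: cvgB; [exact: cvg_fst|exact: cvg_cst].
  have cpsi : continuous psi.
    move=> w; apply: (@continuous_comp _ _ _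
      (fun w : Y => `|w - y'| ^+ 2 + s ^+ 2)); last exact: sqrt_continuous.
    apply: cvgD; last exact: cvg_cst.
    apply: (@continuous_comp _ _ _ (fun w : Y => w - y')
      (fun h : Y => `|h| ^+ 2)); last exact: continuous_sqr_norm.
    by apply: cvgB; [exact: cvg_id|exact: cvg_cst].
  have c2 : continuous (fun q : X * Y => psi q.2).
    by move=> q; apply: (@continuous_comp _ _ _ snd psi);
      [exact: cvg_snd|exact: cpsi].
  move=> q; apply: (cvgD (c1 q)); apply: cvgM; first exact: cvg_cst.
  by apply: (cvgB (c2 q)); exact: cvg_cst.
have r0 : 0 <= r by exact: normr_ge0.
have Up : U p.
  by apply: nbhs_singleton; apply: Unbhs; rewrite subrr normr0;
    apply: divr_ge0 => //; exact: ltW.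
have [z [Az le_r min_uv]] := ekeland _ f lambda p clG ctf f0 l0 (conj Gp Up).
move: z => [u v] in Az le_r min_uv *; have [Guv Uuv] := Az.
rewrite fp in le_r.
have [ux|ux] := eqVneq u x.
  left; exists v; rewrite -ux//.
  by move: le_r; rewrite /f ux /= subrr normr0 add0r.
right.
have near_uv : `|(u, v) - p| <= r / lambda.
  rewrite ler_pdivlMr// mulrC.
  have le_N : `|(u, v) - p| <= l2norm ((u, v) - p).
    by rewrite [leLHS]/Num.norm/= ge_max ler_l2norm1 ler_l2norm2.
  by have := f0 (u, v); have := ler_wpM2l (ltW l0) le_N; lra.
have [zeta [zeta1 zetaN] zetaE] := sqr_norm_subgradient smoothX (x - u).
have [eta [eta1 etaN] etaE] := sqr_norm_subgradient smoothY (v - y').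
set rho := `|x - u| in zeta1 zetaN zetaE.
have rho0 : 0 < rho by rewrite normr_gt0 subr_eq0 eq_sym.
have psi0 : 0 < psi v by apply: lt_le_trans (psi_s v).
have c0 : 0 <= mu * rho / psi v by rewrite divr_ge0 ?mulr_ge0 // ltW.
(* The negative gradient of [f] is scaled by [rho]: its first component becomes [zeta], a duality
   image of x - u, and its second [- c *: eta]. *)
set c := mu * rho / psi v in c0.
exists u, v, zeta, (- c *: eta); split => //.
- apply/eps_normal_coneP => e e0.
  have [d1 d10 d1E] := zetaE _ e0.
  (* The denominator is c + 1 because [c] vanishes for mu = 0. *)
  have c1 : 0 < e / (c + 1) by rewrite divr_gt0// ltr_wpDl.
  have [d2 d20 d2E] := etaE _ c1.
  have /nbhs_ballP[d3 /= d30 d3U] := Unbhs _ near_uv.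
  exists (Order.min d1 (Order.min d2 d3)); first by rewrite !lt_min d10 d20.
  move=> [u1 v1] Gq; rewrite !lt_min => /and3P[qd1 qd2 qd3].
  have Uq : U (u1, v1) by apply: d3U; rewrite -ball_normE /ball_ /= distrC.
  have le_f := min_uv (u1, v1) (conj Gq Uq).
  have h1d : `|u1 - u| < d1.
    by apply: le_lt_trans qd1; rewrite [leRHS]/Num.norm/= le_max lexx.
  have h2d : `|v1 - v| < d2.
    by apply: le_lt_trans qd2; rewrite [leRHS]/Num.norm/= le_max lexx orbT.
  rewrite /= [X in _ + X](_ : _ = - c * eta (v1 - v))//.
  set N := l2norm (_ - _).
  have N1 : `|u1 - u| <= N by exact: (ler_l2norm1 ((u1, v1) - (u, v))).
  have N2 : `|v1 - v| <= N by exact: (ler_l2norm2 ((u1, v1) - (u, v))).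
  have N0 : 0 <= N by exact: l2norm_ge0.
  have := d1E (- (u1 - u)); rewrite normrN => /(_ h1d).
  rewrite linearN (_ : x - u - (u1 - u) = x - u1);
    last by rewrite opprB addrA subrK.
  have := d2E _ h2d; rewrite (_ : v - y' + (v1 - v) = v1 - y');
    last by rewrite addrC addrA subrK.
  rewrite /f/= [`|u1 - x|]distrC [`|u - x|]distrC -/rho in le_f.
  set z1 := zeta _; set z2 := eta _ => le2 le1.
  rewrite -/N in le_f.
  (* Ekeland's penalty scaled by [rho] has slope lambda rho; the cone allows lambda times the norm
     of the pair, which is at least [rho]. *)
  have L : rho <= l2norm ((zeta, - c *: eta) : dual X * dual Y).
    rewrite -zetaN.
    exact: (ler_l2norm1 ((zeta, - c *: eta) : dual X * dual Y)).
  (* The square root is concave, so upper estimates for the increments of the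
     squared norms suffice. *)
  have := lerB_sqr_div _ _ (psi v1) psi0; rewrite !psiE.
  have := lerB_sqr_div _ _ `|x - u1| rho0.
  rewrite ler_pdivlMr ?mulr_gt0// => t1.
  rewrite ler_pdivlMr ?mulr_gt0// => t2.
  have s1 : rho * (`|x - u1| - rho) <= - z1 + e / 2 * N.
    by have := ler_wpM2l (ltW e0) N1; lra.
  have s2 : mu * rho * (psi v1 - psi v) <= c * z2 + e / 2 * N.
    have -> : mu * rho * (psi v1 - psi v) =
        c / 2 * ((psi v1 - psi v) * (2 * psi v)).
      by rewrite /c; field; rewrite gt_eqF.
    have : e / (c + 1) * `|v1 - v| <= e / (c + 1) * N.
      by rewrite ler_wpM2l// ltW.
    have : c / 2 * (e / (c + 1) * N) <= e / 2 * N.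
      rewrite (_ : c / 2 * _ = (c / (c + 1)) * (e / 2 * N)); last first.
        by field; rewrite gt_eqF// ltr_wpDl.
      rewrite ler_piMl ?mulr_ge0 ?divr_ge0 ?(ltW e0)//.
      by rewrite ler_pdivrMr ?ltr_wpDl// mul1r lerDl.
    move=> le3 le4; apply: (@le_trans _ _ (c / 2 * (2 * z2 + e / (c + 1) * N))).
      by apply: ler_wpM2l; lra.
    by lra.
  have s3 : lambda * rho * N <=
      lambda * l2norm ((zeta, - c *: eta) : dual X * dual Y) * N.
    by rewrite ler_wpM2r// ler_wpM2l// ltW.
  have : 0 <= rho * (`|x - u1| - rho + mu * (psi v1 - psi v) + lambda * N).
    by apply: mulr_ge0; [exact: ltW|lra].
  by lra.
- exists (x - u) => //; apply: convex_tangent_cone => //; exact: (GO (u, v)).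
- by rewrite -normr_gt0 zetaN.
- rewrite normrZ normrN zetaN etaN ger0_norm// /c mulrAC ler_pdivrMr//.
  by rewrite ler_wpM2l// mulr_ge0// ltW.
Qed.

End variational.

(** * Necessity: normals under the Lipschitz-like property *)

Section necessity.
Context {R : realType} {X Y : normedModType R}.

(** Let [xs] be a duality image of the tangent vector w. Over x + t_k w_k there is a graph point
    whose second component is within kappa t_k |w_k| of [y], so its Euclidean distance from (x, y)
    is at most sqrt(kappa^2 + 1) t_k |w_k|. Testing the normal there and dividing by t_k bounds
    xs(w_k), which tends to |w|^2. *)
Lemma lipschitz_like_normal (S : X -> set Y) (Omega : set X) (xbar : X)
    (ybar : Y) (kappa : R) :
  0 <= kappa -> lipschitz_like S Omega xbar ybar kappa ->
  exists2 delta, 0 < delta & forall x y,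
    (gph (restriction S Omega) `&`
      (closed_ball xbar delta `*` closed_ball ybar delta)) (x, y) ->
    forall eps xs ys, 0 <= eps ->
    eps_normal_cone eps (x, y) (gph (restriction S Omega)) (xs, ys) ->
    duality_image (tangent_cone x Omega) xs ->
    `|xs| <= kappa * `|ys| +
      eps * Num.sqrt (kappa ^+ 2 + 1) * l2norm ((xs, ys) : dual X * dual Y).
Proof.
move=> k0 [V [W [/nbhs_ballP[dV /= dV0 sV] /nbhs_ballP[dW /= dW0 sW] lipVW]]].
pose d := Order.min dV dW; have d0 : 0 < d by rewrite lt_min dV0.
(* The other half of [d] is left for the increment [h]. *)
exists (d / 2); first by rewrite divr_gt0.
move=> x y [[/= Ox Sxy]]; rewrite !closed_ballE ?divr_gt0// => -[].
rewrite /closed_ball_ /= => xd yd eps xs ys eps0 /eps_normal_coneP Nxs.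
move=> [w [t [w_ [t0 tlim wlim Ow]]] [xsw xsN]].
set C := Num.sqrt _; set L := l2norm _.
have C0 : 0 <= C by exact: sqrtr_ge0.
have CE : C ^+ 2 = kappa ^+ 2 + 1 by rewrite sqr_sqrtr// addr_ge0// sqr_ge0.
have L0 : 0 <= L by exact: l2norm_ge0.
have M0 : 0 <= kappa * `|ys| + eps * C * L by rewrite addr_ge0 ?mulr_ge0.
rewrite xsN; have [->|wn0] := eqVneq w 0; first by rewrite normr0.
have nw : 0 < `|w| by rewrite normr_gt0.
have yW : W y.
  apply: sW; rewrite -ball_normE /ball_ /=; apply: le_lt_trans yd _.
  have : d <= dW by rewrite ge_min lexx orbT.
  lra.
have inV z : `|xbar - z| < d -> V z.
  move=> zd; apply: sV; rewrite -ball_normE /ball_ /=; apply: lt_le_trans zd _.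
  by rewrite ge_min lexx.
have tw0 : t k *: w_ k @[k --> \oo] --> (0 : X).
  by rewrite -(scale0r w); exact: cvgZ.
(* The estimate before the limit: [e] is the slack of the cone, [eta] the error in [w_ k]. *)
have key e eta : 0 < e -> 0 < eta ->
    `|w| ^+ 2 - `|w| * eta <=
      (kappa * `|ys| + (eps * L + e) * C) * (`|w| + eta).
  move=> e0 eta0; have [r r0 rE] := Nxs e e0.
  (* The second bound brings the graph point, at maximum distance at most (kappa + 1)|h|, within the
     radius [r]. *)
  have m0 : 0 < Order.min (d / 2) (r / (kappa + 1)).
    by rewrite lt_min !divr_gt0// ltr_wpDl.
  have : \forall k \near \oo, `|w - w_ k| < eta /\
      `|t k *: w_ k| < Order.min (d / 2) (r / (kappa + 1)).
    apply: filterI; first by move/cvgrPdist_lt : wlim => /(_ eta eta0).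
    move/cvgrPdist_lt : tw0 => /(_ _ m0); apply: filterS => k.
    by rewrite sub0r normrN.
  move=> [k _ /(_ k (leqnn k)) [wk]]; rewrite lt_min => /andP[td tr].
  set h := t k *: w_ k in td tr.
  have xh : V (x + h).
    apply: inV; rewrite opprD addrA.
    by apply: le_lt_trans (ler_normB _ _) _; lra.
  have xV : V x by apply: inV; lra.
  have [u Su [b /closed_ball01 b1 yE]] :
      [set u + (kappa * `|x - (x + h)|) *: b |
        u in S (x + h) & b in closed_ball (0 : Y) 1] y.
    by apply: (lipVW (x + h) x); rewrite //; split=> //; exact: Ow.
  rewrite opprD addrA subrr sub0r normrN in yE.
  have uy : `|u - y| <= kappa * `|h|.
    rewrite -yE opprD addrA subrr sub0r normrN normrZ ger0_norm ?mulr_ge0//.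
    by rewrite ler_piMr// mulr_ge0.
  have hw : `|h| = t k * `|w_ k| by rewrite normrZ gtr0_norm.
  have q1 : (((x + h, u) : X * Y) - (x, y)).1 = h.
    by rewrite -[LHS]/(x + h - x) addrC addKr.
  have Nq : `|((x + h, u) : X * Y) - (x, y)| < r.
    apply: (@le_lt_trans _ _ ((kappa + 1) * `|h|)).
      rewrite [leLHS]/Num.norm/= ge_max q1.
      apply/andP; split; first by rewrite ler_peMl// lerDr.
      by rewrite mulrDl; apply: le_trans uy _; rewrite lerDl mul1r.
    by rewrite mulrC -ltr_pdivlMr// ltr_wpDl.
  have l2q : l2norm (((x + h, u) : X * Y) - (x, y)) <= C * `|h|.
    rewrite -ler_sqr ?nnegrE ?l2norm_ge0 ?mulr_ge0// l2normE2.
    rewrite q1 exprMn CE mulrDl mul1r [leLHS]addrC lerD2r -exprMn.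
    by rewrite ler_sqr ?nnegrE ?mulr_ge0.
  have := rE (x + h, u) (conj (Ow k) Su) Nq; rewrite /= [x + h - x]addrC addKr.
  have ysu : - (`|ys| * (kappa * `|h|)) <= ys (u - y).
    rewrite lerNl; apply: le_trans (ler_norm _) _; rewrite normrN.
    by apply: le_trans (dual_norm_le _ _) _;
      exact: ler_wpM2l (dual_norm_ge0 ys) _ _ uy.
  have B0 : 0 <= eps * L + e by rewrite addr_ge0 ?mulr_ge0// ltW.
  have := ler_wpM2l B0 l2q.
  rewrite linearZ /= -[_ *: xs _]/(_ * xs _) -/L => l2q' le1.
  have le2 : t k * xs (w_ k) <=
      t k * ((kappa * `|ys| + (eps * L + e) * C) * `|w_ k|).
    by rewrite hw in ysu l2q' le1; lra.
  rewrite ler_pM2l// in le2.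
  have w1 : `|w_ k| <= `|w| + eta.
    have -> : w_ k = w - (w - w_ k) by rewrite subKr.
    by apply: le_trans (ler_normB _ _) _; rewrite lerD2l ltW.
  have w2 : xs w - xs (w_ k) <= `|w| * eta.
    rewrite -linearB; apply: le_trans (ler_norm _) _.
    by apply: le_trans (dual_norm_le _ _) _;
      rewrite -[dual_norm xs]/`|xs| xsN ler_wpM2l// ltW.
  have B1 : 0 <= kappa * `|ys| + (eps * L + e) * C.
    by rewrite addr_ge0 ?mulr_ge0.
  have := ler_wpM2l B1 w1; rewrite xsw in w2; lra.
apply/ler_addgt0Pr => e e0.
have e10 : 0 < e / (2 * (C + 1)) by rewrite divr_gt0 ?mulr_gt0 ?ltr_wpDl.
set e1 := e / _ in e10.
set M := kappa * `|ys| + (eps * L + e1) * C.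
have M10 : 0 <= M := addr_ge0 (mulr_ge0 k0 (normr_ge0 _))
  (mulr_ge0 (addr_ge0 (mulr_ge0 eps0 L0) (ltW e10)) C0).
have D0 : 0 < `|w| + M by rewrite ltr_wpDr.
(* This [eta] makes eta (|w| + M) equal to |w| e/2, so that |w| cancels. *)
have := key e1 (`|w| * (e / 2) / (`|w| + M)) e10; rewrite -/M => /(_ _)/wrap[].
  by rewrite !divr_gt0// mulr_gt0// divr_gt0.
set eta := _ / _ => le_eta.
have etaE : eta * (`|w| + M) = `|w| * (e / 2) by rewrite /eta mulfVK// gt_eqF.
have : `|w| * `|w| <= `|w| * (M + e / 2) by lra.
rewrite ler_pM2l// => le_w; apply: le_trans le_w _.
have : e1 * C <= e / 2.
  rewrite (_ : e1 * C = e / 2 * (C / (C + 1))); last first.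
    by rewrite /e1; field; rewrite gt_eqF// ltr_wpDl.
  rewrite ler_piMr ?divr_ge0 ?(ltW e0)//.
  by rewrite ler_pdivrMr ?ltr_wpDl// mul1r lerDl.
by rewrite /M; lra.
Qed.

(** For ys = 0 the preceding bound reads |xs| <= eps sqrt(kappa^2 + 1) |xs|, with a factor below
    1. *)
Lemma lipschitz_like_trivial_normals (S : X -> set Y) (Omega : set X)
    (xbar : X) (ybar : Y) (kappa eps : R) :
  convex_set Omega -> 0 <= kappa -> 0 <= eps ->
  eps * Num.sqrt (kappa ^+ 2 + 1) < 1 ->
  lipschitz_like S Omega xbar ybar kappa ->
  exists2 delta, 0 < delta & trivial_normals S Omega xbar ybar eps delta.
Proof.
move=> cO k0 eps0 lt1 /(lipschitz_like_normal _ _ _ _ _ k0)[delta delta0 H].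
exists delta => // x y Gxy; apply/seteqP; split=> [[xs ys]|_ ->] /=.
  move=> [Nxs [Jxs /= ys0]]; rewrite ys0 in Nxs *.
  have := H _ _ Gxy _ _ _ eps0 Nxs Jxs.
  rewrite /l2norm /= normr0 mulr0 add0r expr0n addr0 sqrtr_sqr normr_id => le1.
  congr (_, _); apply/eqP; rewrite -normr_le0.
  have : (1 - eps * Num.sqrt (kappa ^+ 2 + 1)) * `|xs| <= 0 by lra.
  by rewrite pmulr_rle0// subr_gt0.
have [[Ox _] _] := Gxy; split.
  apply/eps_normal_coneP => e e0; exists 1 => // q _ _ /=.
  rewrite [leLHS](_ : _ = 0 + 0 :> R)// l2norm0 mulr0 !add0r.
  by rewrite mulr_ge0 ?l2norm_ge0// ltW.
split=> //; exists 0.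
  by rewrite -(subrr x); exact: convex_tangent_cone.
by split; rewrite ?linear0 !normr0 ?expr0n.
Qed.

End necessity.

(** * Sufficiency: from normals to the Lipschitz-like property *)

Section sufficiency.
Context {R : realType} {X Y : completeNormedModType R}.
Context (S : X -> set Y) (Omega : set X) (xbar : X) (ybar : Y).
Context (smoothX : frechet_smooth_norm X) (smoothY : frechet_smooth_norm Y).
Context (convexOmega : convex_set Omega).
Let G := gph (restriction S Omega).
Context (closed_gph : locally_closed_around G (xbar, ybar)).

(** Common core of both sufficiency proofs: the condition on normals excludes the second outcome of
    [ekeland_normal], and the numerical condition, where [s] may depend on [r], turns the first into
    the bound kappa r. *)
Lemma normals_lipschitz_like (mu lambda delta kappa : R) :
  0 <= mu -> 0 < lambda -> 0 < delta -> 0 <= kappa ->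
  (forall u v,
    (G `&` (closed_ball xbar delta `*` closed_ball ybar delta)) (u, v) ->
    forall xs ys, eps_normal_cone lambda (u, v) G (xs, ys) ->
    duality_image (tangent_cone u Omega) xs -> `|ys| <= mu * `|xs| -> xs = 0) ->
  (forall r, 0 < r -> exists2 s, 0 < s & forall d, 0 <= d ->
    mu * (Num.sqrt (d ^+ 2 + s ^+ 2) - s) + lambda * Num.sqrt (r ^+ 2 + d ^+ 2)
      <= r -> d <= kappa * r) ->
  lipschitz_like S Omega xbar ybar kappa.
Proof.
move=> mu0 l0 delta0 k0 noN est.
have [U [/nbhs_ballP[d1 /= d10 d1U] clU clG]] := closed_gph.
pose d := Order.min delta d1; have d0 : 0 < d by rewrite lt_min delta0.
(* Chosen so that a + 2a/lambda = d: the start is within [a] of the reference point, and r < 2a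
   bounds the displacement by 2a/lambda. *)
pose a := d * lambda / (lambda + 2).
have l20 : 0 < lambda + 2 by rewrite addr_gt0.
have a0 : 0 < a by rewrite divr_gt0 ?mulr_gt0.
have aE : a + 2 * a / lambda = d.
  by rewrite /a; field; rewrite !gt_eqF.
have near_bar (x x' : X) (y' : Y) (q : X * Y) :
    `|xbar - x| < a -> `|xbar - x'| < a -> `|ybar - y'| < a ->
    `|q - (x', y')| <= `|x' - x| / lambda ->
    `|(xbar, ybar) - q| < d.
  move=> xa x'a y'a qp.
  have rlt : `|x' - x| / lambda < 2 * a / lambda.
    rewrite ltr_pM2r ?invr_gt0//.
    rewrite (_ : x' - x = (xbar - x) - (xbar - x'));
      last by rewrite opprB [RHS]addrC subrKA.
    by apply: le_lt_trans (ler_normB _ _) _; lra.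
  have pa : `|(xbar, ybar) - (x', y')| < a.
    by rewrite [ltLHS]/Num.norm/= gt_max x'a y'a.
  rewrite (_ : _ - q = ((xbar, ybar) - (x', y')) - (q - (x', y'))); last first.
    by rewrite opprB addrA subrK.
  by apply: le_lt_trans (ler_normB _ _) _; lra.
exists (ball xbar a), (ball ybar a); split;
  [exact: nbhsx_ballx|exact: nbhsx_ballx|].
move=> x x' [Ox]; rewrite -ball_normE /ball_/= => xa [Ox'] /= x'a y' [Sx'y'];
  rewrite -ball_normE /ball_/= => y'a.
suff [v [Sxv vle]] : exists v, S x v /\ `|y' - v| <= kappa * `|x' - x|.
  exists v => //.
  have [c0|c0] := eqVneq (kappa * `|x' - x|) 0.
    exists 0; first by apply/closed_ball01; rewrite normr0.
    by rewrite scaler0 addr0; apply/esym/subr0_eq/eqP; rewrite -normr_le0 -c0.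
  have cp : 0 < kappa * `|x' - x| by rewrite lt_def c0 mulr_ge0.
  exists ((kappa * `|x' - x|)^-1 *: (y' - v)).
    apply/closed_ball01; rewrite normrZ normfV (gtr0_norm cp).
    by rewrite mulrC ler_pdivrMr// mul1r.
  by rewrite scalerA mulfV// scale1r addrC subrK.
have [->|xx'] := eqVneq x x'.
  by exists y'; rewrite !subrr !normr0 mulr0.
have r0 : 0 < `|x' - x| by rewrite normr_gt0 subr_eq0 eq_sym.
have [s s0 sE] := est _ r0.
have nbhsU q : `|q - (x', y')| <= `|x' - x| / lambda -> nbhs q U.
  move=> qp; apply: (@filterS _ _ _ (ball (xbar, ybar) d1)) => //.
  apply: open_nbhs_nbhs; split; first exact: ball_open.
  rewrite -ball_normE; change (`|(xbar, ybar) - q| < d1).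
  apply: lt_le_trans (near_bar _ _ _ _ xa x'a y'a qp) _.
  by rewrite ge_min lexx orbT.
have [[v [_ Sxv] le_r]|[u [v [xs [ys [[Guv near_uv] Nxs Jxs xs0 ysle]]]]]] :=
  ekeland_normal smoothX smoothY G U Omega x x' y' mu lambda s convexOmega
    (fun q => @proj1 _ _) clG mu0 l0 s0 Ox (conj Ox' Sx'y') nbhsU.
- exists v; split=> //; rewrite distrC; apply: sE => //; apply: le_trans le_r.
  by rewrite lerD2l /l2norm/= [`|x' - x|]distrC.
- suff xsE : xs = 0 by rewrite xsE eqxx in xs0.
  apply: (noN u v _ _ _ Nxs Jxs ysle); split => //.
  have lt_d := near_bar _ _ _ _ xa x'a y'a near_uv.
  have le_delta : d <= delta by rewrite ge_min lexx.
  move: lt_d; rewrite [ltLHS]/Num.norm/= gt_max => /andP[ud vd].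
  by split; rewrite /= closed_ballE// /closed_ball_/=;
    apply: le_trans le_delta; exact: ltW.
Qed.

(** With mu = 0 only normals with ys = 0 matter, and eps sqrt(r^2 + d^2) <= r is exactly d <=
    sqrt(1/eps^2 - 1) r, so no constant is lost. *)
Lemma trivial_normals_lipschitz_like (eps delta : R) :
  0 < eps -> eps < 1 -> 0 < delta ->
  trivial_normals S Omega xbar ybar eps delta ->
  lipschitz_like S Omega xbar ybar (Num.sqrt (1 / eps ^+ 2 - 1)).
Proof.
move=> e0 e1 delta0 triv.
have e2 : 0 < eps ^+ 2 by rewrite exprn_gt0.
have ge1 : 0 <= 1 / eps ^+ 2 - 1.
  by rewrite subr_ge0 ler_pdivlMr// mul1r expr_le1// ltW.
apply: (@normals_lipschitz_like 0 eps delta) => //.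
  move=> u v Guv xs ys Nxs Jxs; rewrite mul0r normr_le0 => /eqP ys0.
  have : (eps_normal_cone eps (u, v) G `&`
      (duality_image (tangent_cone u Omega) `*` [set 0])) (xs, ys) by split.
  by rewrite (triv u v Guv) => -[].
move=> r r0; exists 1 => // d d0; rewrite mul0r add0r => le_r.
rewrite -ler_sqr ?nnegrE ?mulr_ge0 ?sqrtr_ge0 ?(ltW r0)//.
rewrite exprMn sqr_sqrtr// div1r mulrBl mul1r lerBrDr [leLHS]addrC.
rewrite [leRHS]mulrC ler_pdivlMr// mulrC.
have := le_r.
rewrite -ler_sqr ?nnegrE ?mulr_ge0 ?sqrtr_ge0 ?(ltW r0) ?(ltW e0)//.
by rewrite exprMn sqr_sqrtr// addr_ge0// sqr_ge0.
Qed.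

End sufficiency.

(** * Conversion between kappa and eps *)

Lemma sqrt_sqrD1_gt0 (R : realType) (a : R) : 0 < Num.sqrt (a ^+ 2 + 1).
Proof. by rewrite sqrtr_gt0 ltr_wpDl// sqr_ge0. Qed.

Lemma ltr_sqrt_sqrD1 (R : realType) (a b : R) : 0 <= a -> a < b ->
  Num.sqrt (a ^+ 2 + 1) < Num.sqrt (b ^+ 2 + 1).
Proof.
move=> a0 ab; rewrite ltr_sqrt; last by rewrite ltr_wpDl// sqr_ge0.
by rewrite ltrD2r ltr_sqr ?nnegrE// (le_trans a0)// ltW.
Qed.

Lemma inv_sqrt_sqrD1_spec (R : realType) (kappa : R) : 0 < kappa ->
  [/\ 0 < (Num.sqrt (kappa ^+ 2 + 1))^-1, (Num.sqrt (kappa ^+ 2 + 1))^-1 < 1 &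
    Num.sqrt (1 / (Num.sqrt (kappa ^+ 2 + 1))^-1 ^+ 2 - 1) = kappa].
Proof.
move=> k0; have k2 : 0 < kappa ^+ 2 + 1 by rewrite addr_gt0 ?exprn_gt0.
have C0 : 0 < Num.sqrt (kappa ^+ 2 + 1) by rewrite sqrtr_gt0.
split; first by rewrite invr_gt0.
  rewrite invf_lt1// -[ltLHS]sqrtr1 ltr_sqrt//.
  by rewrite ltrDr exprn_gt0.
rewrite exprVn div1r invrK sqr_sqrtr ?(ltW k2)// addrK sqrtr_sqr.
by rewrite gtr0_norm.
Qed.

(** * Coderivative bounds and the exact Lipschitzian bound *)

Section characterization.
Context {R : realType} {X Y : completeNormedModType R}.
Context (S : X -> set Y) (Omega : set X) (xbar : X) (ybar : Y).
Context (smoothX : frechet_smooth_norm X) (smoothY : frechet_smooth_norm Y).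
Context (convexOmega : convex_set Omega).
Let G := gph (restriction S Omega).
Context (closed_gph : locally_closed_around G (xbar, ybar)).

Definition coderivative_bound (kappa gamma delta : R) :=
  forall x y,
    (G `&` (closed_ball xbar delta `*` closed_ball ybar delta)) (x, y) ->
  forall xs ys,
    (eps_normal_cone gamma (x, y) G `&`
       (duality_image (tangent_cone x Omega) `*` [set: dual Y])) (xs, ys) ->
    `|xs| <= kappa * `|ys|.

(** With g = gamma C, the necessity estimate gives |xs| <= kappa1 |ys| + g (|xs| + |ys|); for small
    g the term in |xs| is absorbed on the left. *)
Lemma lipschitz_like_coderivative_bound (kappa1 kappa eps0 : R) :
  0 <= kappa1 -> kappa1 < kappa -> 0 < eps0 ->
  lipschitz_like S Omega xbar ybar kappa1 ->
  exists gamma delta, [/\ 0 < gamma, gamma < eps0, 0 < delta &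
    coderivative_bound kappa gamma delta].
Proof.
move=> k1 k1k e0 /(lipschitz_like_normal _ _ _ _ _ k1)[delta delta0 H].
set C := Num.sqrt _ in H.
have C0 : 0 < C by exact: sqrt_sqrD1_gt0.
have Ck : 0 < C * (1 + kappa) by rewrite mulr_gt0// ltr_wpDr//; lra.
(* The second entry ensures kappa1 + g <= kappa (1 - g). *)
pose gamma := Order.min (eps0 / 2) ((kappa - kappa1) / (C * (1 + kappa))).
have g0 : 0 < gamma by rewrite lt_min !divr_gt0// subr_gt0.
exists gamma, delta; split=> //.
  by apply: (@le_lt_trans _ _ (eps0 / 2)); [rewrite ge_min lexx|lra].
move=> x y Gxy xs ys [Nxs [/= Jxs _]].
have := H x y Gxy gamma xs ys (ltW g0) Nxs Jxs.
have := l2norm_le_sum ((xs, ys) : dual X * dual Y); rewrite /=.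
set L := l2norm _ => le_L.
have gC0 : 0 < gamma * C by rewrite mulr_gt0.
have := ler_wpM2l (ltW gC0) le_L.
have : gamma * C * (1 + kappa) <= kappa - kappa1.
  by rewrite -mulrA -ler_pdivlMr// ge_min lexx orbT.
set g := gamma * C in gC0 *; set a := `|xs|; set b := `|ys| => h1 h2 h3.
have b0 : 0 <= b by exact: normr_ge0.
have g1 : 0 < 1 - g.
  have : g * (1 + kappa) < 1 * (1 + kappa) by lra.
  by rewrite ltr_pM2r ?subr_gt0//; lra.
rewrite -(ler_pM2l g1).
have := ler_wpM2r b0 h1; lra.
Qed.

(** With mu = 1/k2 and kappa1 < k2, a normal to be excluded satisfies k2 |ys| <= |xs| <= kappa1
    |ys|, hence vanishes. *)
Lemma coderivative_bound_lipschitz_like (kappa1 kappa gamma delta : R) :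
  0 <= kappa1 -> kappa1 < kappa -> 0 < gamma -> 0 < delta ->
  coderivative_bound kappa1 gamma delta ->
  lipschitz_like S Omega xbar ybar kappa.
Proof.
move=> k1 k1k g0 delta0 H.
pose k2 := (kappa1 + kappa) / 2.
have k20 : 0 < k2 by rewrite /k2; lra.
have k1k2 : kappa1 < k2 by rewrite /k2; lra.
have k2k : k2 < kappa by rewrite /k2; lra.
apply: (normals_lipschitz_like _ _ _ _ smoothX smoothY convexOmega closed_gph
  k2^-1 gamma delta) => //; rewrite ?invr_ge0 ?ltW//; first lra.
  move=> u v Guv xs ys Nxs Jxs le1; apply/eqP; rewrite -normr_le0.
  have le2 := H u v Guv xs ys (conj Nxs (conj Jxs I)).
  have : k2 * `|ys| <= `|xs| by rewrite -ler_pdivlMl.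
  have := normr_ge0 xs; have := normr_ge0 ys.
  set a := `|xs| in le2 *; set b := `|ys| in le2 * => b0 a0 le3.
  nra.
(* The gap between [k2] and [kappa] pays for the smoothing: d <= sqrt(d^2 + s^2) <= k2 r + s = kappa
   r. *)
move=> r r0; exists ((kappa - k2) * r); first by rewrite mulr_gt0// subr_gt0.
move=> d d0 le_r; set s := (kappa - k2) * r in le_r.
apply: (@le_trans _ _ (Num.sqrt (d ^+ 2 + s ^+ 2))).
  by rewrite -ler_sqr ?nnegrE ?sqrtr_ge0// sqr_sqrtr ?addr_ge0 ?sqr_ge0// lerDl
    sqr_ge0.
have : k2^-1 * (Num.sqrt (d ^+ 2 + s ^+ 2) - s) <= r.
  by apply: le_trans le_r; rewrite lerDl mulr_ge0 ?sqrtr_ge0// ltW.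
by rewrite ler_pdivrMl// /s; lra.
Qed.

(** A larger delta admits fewer eps, so the limit at 0 from the right is the infimum over all delta
    > 0; this is compared with [lip] in both directions. *)
Lemma lip_limit :
  ereal_inf [set (Num.sqrt (1 / eps ^+ 2 - 1))%:E | eps in
    [set eps : R | [/\ 0 < eps, eps < 1
                     & trivial_normals S Omega xbar ybar eps delta]]]
    @[delta --> (0 : R)^'+] --> lip S Omega xbar ybar.
Proof.
set E := fun delta : R => ereal_inf _.
have Emono : {in Interval (BRight (0 : R)) +oo%O &,
    {homo E : n m / n <= m >-> (n <= m)%E}}.
  move=> m n _ _ mn; apply: le_ereal_inf => _ [eps [e0 e1 triv] <-].
  exists eps => //; split=> // x y [Gxy [xm ym]]; apply: triv; split=> //.
  by split; apply: le_closed_ball mn _ _.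
have := nondecreasing_at_right_cvge (@BInfty R false) isT Emono.
suff -> : lip S Omega xbar ybar = ereal_inf [set E x | x in [set` `]0, +oo[]]
  by [].
apply/eqP; rewrite eq_le; apply/andP; split.
  apply: le_ereal_inf_tmp => _ [delta /= + <-];
    rewrite in_itv /= andbT => delta0.
  apply: le_ereal_inf_tmp => _ [eps [e0 e1 triv] <-].
  apply: ereal_inf_lbound; exists (Num.sqrt (1 / eps ^+ 2 - 1)) => //; split.
    exact: sqrtr_ge0.
  exact: (trivial_normals_lipschitz_like S Omega xbar ybar smoothX smoothY
    convexOmega closed_gph _ _ e0 e1 delta0 triv).
apply: le_ereal_inf_tmp => _ [kappa [k0 lipk] <-].
(* Raising [kappa] by [e] gives a [c] below 1 even for kappa = 0, and makes c sqrt(kappa^2 + 1) < 1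
   strict. *)
apply/lee_addgt0Pr => e e0; rewrite -EFinD.
have ke : 0 < kappa + e by rewrite ltr_wpDl.
have [c0 c1 cE] := inv_sqrt_sqrD1_spec _ _ ke.
set c := _^-1 in c0 c1 cE.
have [|delta delta0 triv] := lipschitz_like_trivial_normals S Omega xbar ybar
  kappa c convexOmega k0 (ltW c0) _ lipk.
  by rewrite /c ltr_pdivrMl ?sqrt_sqrD1_gt0// mulr1 ltr_sqrt_sqrD1// ltrDl.
apply: (@le_trans _ _ (E delta)).
  by apply: ereal_inf_lbound; exists delta => //=; rewrite in_itv/= delta0.
by rewrite -cE; apply: ereal_inf_lbound; exists c.
Qed.

End characterization.

(** * The cycle of implications and the formula *)

Theorem theorem3p4 (R : realType) (X Y : completeNormedModType R)
    (reflX : reflexive_space X) (reflY : reflexive_space Y)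
    (normX : standing_renorming X) (normY : standing_renorming Y)
    (S : X -> set Y) (Omega : set X)
    (closedOmega : closed Omega) (convexOmega : convex_set Omega)
    (xbar : X) (ybar : Y)
    (graph_bar : gph (restriction S Omega) (xbar, ybar))
    (closed_gph :
      locally_closed_around (gph (restriction S Omega)) (xbar, ybar))
    (eps0 kappa0 : R) (eps0_gt0 : 0 < eps0) (eps0_lt1 : eps0 < 1)
    (kappa0_ge0 : 0 <= kappa0)
    (eps0E : eps0 = 1 / Num.sqrt (kappa0 ^+ 2 + 1)) :
  let G := gph (restriction S Omega) in
  [<->
    (forall kappa, kappa0 < kappa -> lipschitz_like S Omega xbar ybar kappa);
    (forall eps, 0 < eps -> eps < eps0 ->
      exists2 delta, 0 < delta & trivial_normals S Omega xbar ybar eps delta);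
    (forall kappa, kappa0 < kappa ->
      exists gamma delta, [/\ 0 < gamma, gamma < eps0, 0 < delta &
        forall x y,
          (G `&` (closed_ball xbar delta `*` closed_ball ybar delta)) (x, y) ->
        forall xs ys,
          (eps_normal_cone gamma (x, y) G `&`
             (duality_image (tangent_cone x Omega) `*` [set: dual Y]))
            (xs, ys) ->
          `|xs| <= kappa * `|ys| ])]
  /\
  ereal_inf [set (Num.sqrt (1 / eps ^+ 2 - 1))%:E | eps in
    [set eps : R | [/\ 0 < eps, eps < 1
                     & trivial_normals S Omega xbar ybar eps delta]]]
    @[delta --> (0 : R)^'+] --> lip S Omega xbar ybar.
Proof.
move=> G; have [_ _ smoothX] := normX; have [_ _ smoothY] := normY.
split; last exact: lip_limit.
have C0 := sqrt_sqrD1_gt0 _ kappa0.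
tfae.
- move=> lipS eps e0 elt.
  have lt_inv : Num.sqrt (kappa0 ^+ 2 + 1) < eps^-1.
    by rewrite -[ltLHS]invrK ltf_pV2 ?posrE ?invr_gt0// -div1r -eps0E.
  (* The constant matching [eps]; it exceeds [kappa0] as eps < eps0, and a midpoint keeps eps
     sqrt(k^2 + 1) below 1. *)
  pose k1 := Num.sqrt (eps^-1 ^+ 2 - 1).
  have k1E : k1 ^+ 2 + 1 = eps^-1 ^+ 2.
    rewrite sqr_sqrtr ?subrK// subr_ge0 exprVn invf_ge1 ?exprn_gt0//.
    by rewrite expr_le1// ltW// (lt_trans elt).
  have k10 : kappa0 < k1.
    rewrite -ltr_sqr ?nnegrE ?sqrtr_ge0// -(ltrD2r 1) k1E.
    rewrite -[ltLHS]sqr_sqrtr; last by rewrite addr_ge0 ?sqr_ge0.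
    by rewrite ltr_sqr ?nnegrE ?sqrtr_ge0// invr_ge0 ltW.
  pose k := (kappa0 + k1) / 2.
  have kk0 : kappa0 < k by rewrite /k; lra.
  apply: (lipschitz_like_trivial_normals _ _ _ _ k) (lipS _ kk0) => //.
  - by rewrite ltW// (le_lt_trans _ kk0).
  - exact: ltW.
  rewrite mulrC -ltr_pdivlMr// mul1r -[ltRHS]gtr0_norm ?invr_gt0// -sqrtr_sqr
    -k1E.
  by apply: ltr_sqrt_sqrD1; rewrite /k; lra.
- move=> triv kappa kk.
  (* The route to (iii) passes through the Lipschitz-like property at the midpoint of [kappa0] and
     [kappa], whose matching eps is below [eps0]. *)
  apply: (@lipschitz_like_coderivative_bound _ _ _ _ _ _ _ ((kappa0 + kappa) /
    2)); try lra.
  set k := (kappa0 + kappa) / 2.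
  have k0 : kappa0 < k by rewrite /k; lra.
  have [c0 c1 cE] := inv_sqrt_sqrD1_spec _ _ (le_lt_trans kappa0_ge0 k0).
  rewrite -cE; have [|delta delta0 tr] := triv _ c0.
    by rewrite eps0E div1r ltf_pV2 ?posrE ?sqrt_sqrD1_gt0// ltr_sqrt_sqrD1.
  exact: (trivial_normals_lipschitz_like _ _ _ _ smoothX smoothY
    convexOmega closed_gph _ _ c0 c1 delta0 tr).
- move=> H kappa kk; have [|gamma [delta [g0 _ delta0 bound]]] := H ((kappa0 +
  kappa) / 2).
    by lra.
  by apply: (coderivative_bound_lipschitz_like _ _ _ _ smoothX smoothY
    convexOmega closed_gph _ _ _ _ _ _ g0 delta0 bound); lra.
Qed.
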